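(* Let $R\subseteq\mathbb{Z}^{\mathbf{x}}\times\mathbb{Z}^{\mathbf{x}}$ be a relation such that at least one of the following holds: (1) $\bigcap_{n\ge1}\mathrm{pre}_R^n(\mathbb{Z}^{\mathbf{x}})=\emptyset$; (2) $\mathrm{pre}_R^{n_2}(\mathbb{Z}^{\mathbf{x}})=\mathrm{pre}_R^{n_1}(\mathbb{Z}^{\mathbf{x}})$ for some $n_2>n_1\ge1$; (3) $\mathrm{pre}_R$ is $\cap$-continuous. Then $\mathrm{wrs}(R)=\bigcap_{n\ge1}\mathrm{pre}_R^n(\mathbb{Z}^{\mathbf{x}})$. Moreover, $\mathrm{wrs}(R)=\emptyset$ if (1) holds, and $\mathrm{wrs}(R)=\mathrm{pre}_R^{n_1}(\mathbb{Z}^{\mathbf{x}})$ if (2) holds.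
   Context: $\mathbf{x}=\{x_1,\dots,x_N\}$, $N>0$, is a set of integer variables and $\mathbb{Z}^{\mathbf{x}}$ the set of valuations $\mathbf{x}\to\mathbb{Z}$. For $S\subseteq\mathbb{Z}^{\mathbf{x}}$, $\mathrm{pre}_R(S)=\{\nu\mid\exists\nu'\in S.\ (\nu,\nu')\in R\}$, and $\mathrm{pre}_R^n$ is its $n$-fold iterate. A function $F:2^{\mathbb{Z}^{\mathbf{x}}}\to2^{\mathbb{Z}^{\mathbf{x}}}$ is $\cap$-continuous if $F(\bigcap_{i\ge1}S_i)=\bigcap_{i\ge1}F(S_i)$ for every infinite sequence $\{S_i\}_{i\ge1}$ of subsets of $\mathbb{Z}^{\mathbf{x}}$. A set $S\subseteq\mathbb{Z}^{\mathbf{x}}$ is recurrent for $R$ if $S\subseteq\mathrm{pre}_R(S)$; $\mathrm{wrs}(R)$ (weakest recurrent set) is the union of all recurrent sets for $R$. *)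

(* Defs.v *)
From mathcomp Require Import all_boot all_algebra.
From mathcomp Require Import boolp classical_sets.

Set Implicit Arguments.
Unset Strict Implicit.
Unset Printing Implicit Defensive.

Local Open Scope classical_set_scope.

Definition valuation (N : nat) : Type := {ffun 'I_N -> int}.

Definition pre (N : nat) (R : set (valuation N * valuation N))
    (S : set (valuation N)) : set (valuation N) :=
  [set v | exists2 v', S v' & R (v, v')].

Definition pre_iter (N : nat) (R : set (valuation N * valuation N)) (n : nat)
    (S : set (valuation N)) : set (valuation N) :=
  iter n (pre R) S.

(* The sequence is arbitrary, in particular not assumed to be decreasing. *)
Definition cap_continuous (N : nat)
    (F : set (valuation N) -> set (valuation N)) : Prop :=
  forall S : nat -> set (valuation N),
    F (\bigcap_(i >= 1) S i) = \bigcap_(i >= 1) F (S i).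

Definition recurrent (N : nat) (R : set (valuation N * valuation N)) :
    set (set (valuation N)) :=
  [set S | S `<=` pre R S].

Definition wrs (N : nat) (R : set (valuation N * valuation N)) :
    set (valuation N) :=
  \bigcup_(S in recurrent R) S.

(* Main.v *)
Require Import Defs.
From mathcomp Require Import all_boot all_algebra.
From mathcomp Require Import boolp classical_sets.

Local Open Scope classical_set_scope.

Section PreImage.
Variables (N : nat) (R : set (valuation N * valuation N)).

(** Since [pre R] is monotone, every recurrent set lies in every iterate ([wrs_sub_pre_iter]). For
    the converse, it suffices to enclose the intersection in a recurrent set: itself if it is empty
    or [pre R] commutes with intersections, the repeated iterate if two iterates coincide
    ([wrs_stationary]). *)

Lemma pre_mono (A B : set (valuation N)) : A `<=` B -> pre R A `<=` pre R B.
Proof. by move=> AB v [v' Av' Rvv']; exists v' => //; exact: AB. Qed.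

Lemma pre_iter_anti m n : m <= n ->
  pre_iter R n setT `<=` pre_iter R m setT.
Proof.
by elim: m n => [|m IHm] [|n] // le_mn; apply: pre_mono; exact: IHm.
Qed.

(** Induction on [n]: [S] lies in [pre R S], and [pre R] preserves the inclusion given by [IHn]. *)
Lemma recurrent_sub_pre_iter (S : set (valuation N)) n :
  recurrent R S -> S `<=` pre_iter R n setT.
Proof.
move=> recS; elim: n => // n IHn v Sv.
exact: pre_mono IHn _ (recS v Sv).
Qed.

Lemma wrs_sub_pre_iter n : wrs R `<=` pre_iter R n setT.
Proof. by move=> v [S recS Sv]; exact: recurrent_sub_pre_iter Sv. Qed.

Lemma recurrent_sub_wrs (S : set (valuation N)) :
  recurrent R S -> S `<=` wrs R.
Proof. by move=> recS v Sv; exists S. Qed.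

(* The iterates decrease, so a repetition pins every iterate in between. *)
Lemma wrs_stationary n1 n2 : n1 < n2 ->
  pre_iter R n2 setT = pre_iter R n1 setT -> wrs R = pre_iter R n1 setT.
Proof.
move=> lt12 eq12; apply/seteqP; split; first exact: wrs_sub_pre_iter.
(* Only the left side becomes iterate [n2]; the right side, [pre R] of iterate [n1], is iterate
   [n1.+1], and [n1.+1 <= n2]. *)
apply: recurrent_sub_wrs; rewrite /recurrent /= -[X in X `<=` _]eq12.
exact: (pre_iter_anti n1.+1).
Qed.

End PreImage.

Theorem lemma3p7 (N : nat) (hN : 0 < N)
    (R : set (valuation N * valuation N))
    (hR : [\/ \bigcap_(n >= 1) pre_iter R n setT = set0,
              exists n1 n2 : nat,
                [/\ 1 <= n1, n1 < n2 & pre_iter R n2 setT = pre_iter R n1 setT]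
            | cap_continuous (pre R)]) :
  [/\ wrs R = \bigcap_(n >= 1) pre_iter R n setT,
      \bigcap_(n >= 1) pre_iter R n setT = set0 -> wrs R = set0
    & forall n1 n2 : nat, 1 <= n1 -> n1 < n2 ->
        pre_iter R n2 setT = pre_iter R n1 setT ->
        wrs R = pre_iter R n1 setT].
Proof.
have wrsE : wrs R = \bigcap_(n >= 1) pre_iter R n setT.
  apply/seteqP; split=> [v wv n _|]; first exact: wrs_sub_pre_iter.
  case: hR => [-> //|[n1 [n2 [n1_gt0 lt12 eq12]]]|cont].
    by rewrite (wrs_stationary _ _ _ _ lt12 eq12) => v; apply.
  (* By continuity, [pre R] of the intersection is the intersection of the iterates [n.+1], which
     drops only one constraint. *)
  apply: recurrent_sub_wrs; rewrite /recurrent /= cont => v capv n _.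
  exact: (capv n.+1).
split=> // [<- //|n1 n2 _]; exact: wrs_stationary.
Qed.
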